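(* For every ordinal $\alpha$ with $1\leqslant\alpha<\omega_1$, the vector lattice $V_\alpha=H_\alpha^1\times H_\alpha^\alpha$ with the pointwise lexicographic order, as defined in the context, has almost Archimedeanization type $\lambda_{V_\alpha}=\alpha$.
   Context: All vector spaces are real, $\mathbb N=\{1,2,\dots\}$, and $\omega_1$ is the first uncountable ordinal. A pre-ordered vector space (POVS) is a vector space $X$ with a wedge $X_+$ (non-empty, closed under addition and under multiplication by scalars $t\ge0$); $x\le y$ iff $y-x\in X_+$. An order ideal of $X$ is a vector subspace $A$ such that $a\le x\le b$ with $a,b\in A$ implies $x\in A$; then $X/A$ is pre-ordered by the wedge $[X_+]=\{[x]:x\in X_+\}$. Infinitesimals: $N_X=\{x\in X:\exists\,\xi\in X_+\ \forall n\in\mathbb N\ \ \pm nx+\xi\in X_+\}$. Put $N_0(X)=\{0\}$ and, for every ordinal $\lambda>0$, with $M_\lambda=\bigcup_{\gamma<\lambda}N_\gamma(X)$, put $N_\lambda(X)=\{x\in X:[x]\in N_{X/M_\lambda}\}$ (all $N_\lambda(X)$ and $M_\lambda$ are order ideals of $X$). The almost Archimedeanization type $\lambda_X$ of $X$ is the first ordinal $\lambda$ such that $N_{\lambda+1}(X)=N_\lambda(X)$. Construction. For each countable limit ordinal $\alpha$ fix a strictly increasing cofinal sequence $A_\alpha:\mathbb N\to\alpha$ with values $\ge1$. For $1<\alpha<\omega_1$ and $n\in\mathbb N$ let $\alpha(n)=\beta$ if $\alpha=\beta+1$, and $\alpha(n)=A_\alpha(n)$ if $\alpha$ is a limit ordinal.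 Let $\mathcal P$ be the space of real polynomials in one variable. Define recursively $S_1=\mathbb R$, $1_1=1$, and for $1<\alpha<\omega_1$ $$1_\alpha=(1_{\alpha(n)})_{n\in\mathbb N},\qquad S_\alpha=\mathcal P1_\alpha+\bigoplus_{n\in\mathbb N}S_{\alpha(n)}\subset\prod_{n\in\mathbb N}S_{\alpha(n)},$$ where $p1_\alpha=(p(n)1_{\alpha(n)})_{n\in\mathbb N}$ for $p\in\mathcal P$. Thus elements of $S_\alpha$ are sequences $(x_n)$, $x_n\in S_{\alpha(n)}$, with $x_n=p(n)1_{\alpha(n)}$ for all but finitely many $n$, for some $p\in\mathcal P$. Let $I_1$ be a one-point set and $I_\alpha=\coprod_{n\in\mathbb N}I_{\alpha(n)}$ for $\alpha>1$; then $S_\alpha$ is identified recursively with a subspace of $\mathbb R^{I_\alpha}$ (with coordinates $x(i)$, $i\in I_\alpha$), ordered pointwise. For $1\leqslant\beta<\omega_1$ define subspaces $H_\alpha^\beta\subseteq S_\alpha$ recursively by $H_\alpha^\beta=\bigoplus_{n\in\mathbb N}H_{\alpha(n)}^\beta$ if $\beta<\alpha$, and $H_\alpha^\beta=S_\alpha$ if $\beta\geqslant\alpha$. (So $H_\alpha^1=c_{00}(I_\alpha)$ and $H_\alpha^\alpha=S_\alpha$.) Let $V_\alpha=H_\alpha^1\times H_\alpha^\alpha$ with the pointwise lexicographic order $$0\leqslant(x,y)\iff\text{for all }i\in I_\alpha:\ 0<x(i)\ \text{ or }\ (0=x(i)\text{ and }0\leqslant y(i)).$$ *)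

(* Defs.v *)
From HB Require Import structures.
From mathcomp Require Import all_boot all_order all_algebra.
From mathcomp Require Import generic_quotient ring_quotient.
From mathcomp Require Import all_classical all_reals.
From mathcomp Require wochoice polyrcf.

Set Implicit Arguments.
Unset Strict Implicit.
Unset Printing Implicit Defensive.

Import Order.TTheory GRing.Theory Num.Theory.

Local Open Scope classical_set_scope.
Local Open Scope ring_scope.
Local Open Scope order_scope.

(* A well-ordered type without a last element, i.e. (up to isomorphism) the
   ordinals below some limit ordinal; an element stands for the order type of
   the set of its predecessors, so \bot is 0 and ord_succ is +1. *)
HB.mixin Record BTotal_isOrdinals d W of Order.BTotal d W := {
  wf_lt : well_founded (fun x y : W => x < y);
  ord_succ : W -> W;
  succ_le : forall x y : W, (ord_succ x <= y) = (x < y)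
}.

#[short(type="ordinalsType")]
HB.structure Definition Ordinals d :=
  { W of Order.BTotal d W & BTotal_isOrdinals d W }.

Section OrdinalsTheory.
Context {d : Order.disp_t} {W : ordinalsType d}.
Implicit Types a b : W.

Definition ord_one : W := ord_succ \bot.

Definition is_limit a := a <> \bot /\ forall b, a <> ord_succ b.

Lemma lt_succ a : a < ord_succ a. Proof. by rewrite -succ_le. Qed.

Lemma one_le a : (ord_one <= a) = (a != \bot).
Proof. by rewrite succ_le lt0x. Qed.

Lemma ord_ind (P : W -> Prop) :
  (forall a, (forall b, b < a -> P b) -> P a) -> forall a, P a.
Proof. exact: (well_founded_ind wf_lt). Qed.

End OrdinalsTheory.

Arguments ord_one {d W}.

(* The first uncountable ordinal, realised as the initial segment of a
   well-ordering of the uncountable type set nat formed by the points with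
   countably many predecessors.  Up to isomorphism it is characterised by
   omega1_wf, omega1_countable_initial and omega1_uncountable. *)
Definition set_nat_wo : rel (set nat) :=
  sval (wochoice.well_ordering_principle (set nat)).

Definition omega1 := {x : set nat |
  `[< countable [set y | set_nat_wo y x /\ y <> x] >]}.

Section Omega1Order.

Let woP : wochoice.well_order set_nat_wo.
Proof. exact: (svalP (wochoice.well_ordering_principle (set nat))). Qed.

Let wo_chT : wochoice.wo_chain set_nat_wo predT.
Proof. by move=> A _; exact: woP. Qed.

Definition omega1_le (x y : omega1) := set_nat_wo (val x) (val y).

Lemma omega1_le_refl : reflexive omega1_le.
Proof. by move=> x; apply: (wochoice.wo_chain_reflexive wo_chT). Qed.

Lemma omega1_le_anti : antisymmetric omega1_le.
Proof. by move=> x y h; apply/val_inj/(wochoice.wo_chain_antisymmetric wo_chT). Qed.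

Lemma omega1_le_total : total omega1_le.
Proof. by move=> x y; apply: (wochoice.wo_chainW wo_chT). Qed.

Let wo_trans : transitive set_nat_wo.
Proof.
move=> y x z xy yz.
have [|w [[wA wm] _]] := woP (A := [pred t | [|| t == x, t == y | t == z]]).
  by exists x; rewrite !inE eqxx.
have wx : set_nat_wo w x by apply: wm; rewrite !inE eqxx.
have wy : set_nat_wo w y by apply: wm; rewrite !inE eqxx orbT.
have wz : set_nat_wo w z by apply: wm; rewrite !inE eqxx !orbT.
have anti a b : set_nat_wo a b -> set_nat_wo b a -> a = b.
  by move=> ab ba; apply: (wochoice.wo_chain_antisymmetric wo_chT) => //; rewrite ab.
move: wA; rewrite !inE => /or3P[]/eqP e; subst w => //.
  by rewrite (anti x y).
by rewrite -(anti y z).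
Qed.

Lemma omega1_le_trans : transitive omega1_le.
Proof. by move=> y x z; apply: wo_trans. Qed.

Fact omega1_display : Order.disp_t. Proof. exact: Order.Disp tt tt. Qed.

HB.instance Definition _ := Choice.on omega1.
HB.instance Definition _ := @Order.Le_isPOrder.Build omega1_display omega1
  omega1_le omega1_le_refl omega1_le_anti omega1_le_trans.
HB.instance Definition _ :=
  @Order.POrder_isTotal.Build omega1_display omega1 omega1_le_total.

Lemma omega1_least (P : set omega1) : P !=set0 ->
  exists2 x, P x & forall y, P y -> x <= y.
Proof.
move=> [x Px].
have [|w [[wA wm] _]] := woP (A :=
    [pred t | `[< exists2 y : omega1, P y & val y = t >]]).
  by exists (val x); apply/asboolP; exists x.
move: wA => /asboolP[y Py yw]; exists y => // z Pz.
by rewrite /Order.le /= /omega1_le yw; apply: wm; apply/asboolP; exists z.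
Qed.

Lemma omega1_wf : well_founded (fun x y : omega1 => x < y).
Proof.
move=> x; apply: contrapT => nx.
have [y ny ym] := @omega1_least
  [set x | ~ Acc (fun x y : omega1 => x < y) x] (ex_intro _ x nx).
apply: ny; constructor => z zy; apply: contrapT => nz.
by have := ym _ nz; rewrite leNgt zy.
Qed.

Lemma omega1_countable_initial (x : omega1) : countable [set y | y < x].
Proof.
have /asboolP/countable_injP[f fi] := valP x.
apply/countable_injP; exists (f \o val) => y z; rewrite !inE /= => yx zx e.
have mem t : t < x -> val t \in [set y | set_nat_wo y (val x) /\ y <> val x].
  by rewrite lt_neqAle => /andP[/eqP tx le_tx]; rewrite inE; split=> // /val_inj.
exact/val_inj/fi/e/mem/zx/mem.
Qed.

Lemma omega1_uncountable : ~ countable [set: omega1].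
Proof.
move=> c; pose U : set (set nat) := [set x |
  `[< countable [set y | set_nat_wo y x /\ y <> x] >]].
have cU : countable U.
  rewrite (_ : U = val @` [set: omega1]); first exact:
    card_le_trans (card_image_le _ _) c.
  apply/seteqP; split=> [x Ux|_ [x _ <-]]; last exact: (valP x).
  by exists (Sub x Ux : omega1).
have [[y nUy]|allU] := pselect (exists y, ~ U y).
  have [|w [[wA wm] _]] := woP (A := [pred t | `[< ~ U t >]]).
    by exists y; apply/asboolP.
  move: wA => /asboolP; apply; apply/asboolP.
  apply: sub_countable cU; apply: subset_card_le => t [tw tnw].
  apply: contrapT => nUt; apply: tnw.
  apply: (wochoice.wo_chain_antisymmetric wo_chT) => //; rewrite tw /=.
  by apply: wm; apply/asboolP.
have {allU}UT (x : set nat) : U x by apply: contrapT => nUx; apply: allU; exists x.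
have /countable_injP[f fi] := cU.
pose D : set nat := [set n | exists2 x : set nat, f x = n & ~ x n].
have nD : ~ D (f D).
  move=> [x e nx]; have xD : x = D by apply: fi; rewrite ?inE.
  by apply: (nx); rewrite {1}xD; exists x.
by apply: (nD); exists D.
Qed.

Lemma omega1_nomax (x : omega1) : exists y, x < y.
Proof.
apply: contrapT => nx; apply: omega1_uncountable.
have le_x y : y <= x by rewrite leNgt; apply/negP => xy; apply: nx; exists y.
have /countable_injP[f fi] := omega1_countable_initial x.
apply/countable_injP; exists (fun y => if y < x then (f y).+1 else 0%N) => y z _ _.
case: ltP (le_x y) => [yx|xy] yx'; case: ltP (le_x z) => [zx|xz] zx' //.
  by move=> [] /fi; apply; rewrite inE.
by move=> _; rewrite -(le_anti (introT andP (conj xy yx'))); apply/le_anti/andP.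
Qed.

Let bot : {x : omega1 | forall y, x <= y}.
Proof.
apply: cid; have [|x _ h] := @omega1_least setT; last by exists x => y; apply: h.
apply: contrapT => n0; apply: omega1_uncountable.
rewrite (_ : [set: omega1] = set0) // -subset0 => x _; exact/n0/(ex_intro _ x).
Qed.

Let suc (x : omega1) : {z : omega1 | forall y, (z <= y) = (x < y)}.
Proof.
apply: cid; have [z xz zm] := omega1_least (omega1_nomax x); exists z => y.
by apply/idP/idP => [zy|/zm //]; exact: lt_le_trans zy.
Qed.

HB.instance Definition _ :=
  @Order.hasBottom.Build omega1_display omega1 (sval bot) (svalP bot).
HB.instance Definition _ := @BTotal_isOrdinals.Build omega1_display omega1
  omega1_wf (fun x => sval (suc x)) (fun x => svalP (suc x)).

End Omega1Order.

Local Open Scope ring_scope.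

Record povs (R : realType) := POVS {
  povs_car :> lmodType R;
  wedge : set povs_car;
  wedge_nonempty : wedge !=set0;
  wedgeD : forall x y, wedge x -> wedge y -> wedge (x + y);
  wedgeZ : forall (t : R) x, 0 <= t -> wedge x -> wedge (t *: x)
}.

Section Subspaces.
Context {R : realType} {X : lmodType R}.
Implicit Types (A B : set X) (x y : X).

Definition is_subspace A :=
  A 0 /\ forall (t : R) x y, A x -> A y -> A (t *: x + y).

Definition lin_span A : {pred X} :=
  fun x => `[< forall B, is_subspace B -> A `<=` B -> B x >].

Lemma lin_span_submod A : submod_closed (lin_span A).
Proof.
split=> [|t x y /asboolP Sx /asboolP Sy]; apply/asboolP => B sB AB.
  by case: sB.
by case: (sB) => _; apply; [apply: Sx|apply: Sy].
Qed.

HB.instance Definition _ A :=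
  GRing.isSubmodClosed.Build R X (lin_span A) (lin_span_submod A).

Lemma lin_spanE A : is_subspace A -> [set x | x \in lin_span A] = A.
Proof.
move=> sA; apply/seteqP; split=> x; rewrite /= unfold_in.
  by move=> /asboolP; apply.
by move=> Ax; apply/asboolP => B _; apply.
Qed.

(* X/A is meaningful when A is a subspace, in which case lin_span A = A; going
   through lin_span A makes it total in A, so that it can be used inside the
   recursion defining inf_ideal before the sets involved are known to be
   subspaces (which they are: inf_ideal_subspace, inf_union_subspace). *)
Definition quot A := @Quotient.quot X (lin_span A).

HB.instance Definition _ A := GRing.Zmodule.on (quot A).
HB.instance Definition _ A := EqQuotient.on (quot A).

Definition quot_class A (x : X) : quot A := \pi_(quot A)%qT x.

Lemma quot_classP A x y :
  reflect (quot_class A x = quot_class A y) (x - y \in lin_span A).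
Proof. by rewrite Quotient.idealrBE; apply: eqP. Qed.

Lemma quot_classD A : {morph quot_class A : x y / x + y}.
Proof. by move=> x y; rewrite /quot_class !piE. Qed.

Lemma quot_class_ind A (P : quot A -> Prop) :
  (forall x, P (quot_class A x)) -> forall u, P u.
Proof. by move=> h u; rewrite -[u]reprK; apply: h. Qed.

Definition quot_scale A (t : R) (u : quot A) : quot A :=
  quot_class A (t *: repr u).

Lemma quot_scale_class A t x :
  quot_scale t (quot_class A x) = quot_class A (t *: x).
Proof.
apply/quot_classP; rewrite -scalerBr rpredZ //; apply/quot_classP.
exact: reprK.
Qed.

Lemma quot_scaleA A (s t : R) (u : quot A) :
  quot_scale s (quot_scale t u) = quot_scale (s * t) u.
Proof. by elim/quot_class_ind: u => x; rewrite !quot_scale_class scalerA. Qed.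

Lemma quot_scale1 A : left_id 1 (@quot_scale A).
Proof. by elim/quot_class_ind => x; rewrite quot_scale_class scale1r. Qed.

Lemma quot_scaleDr A : right_distributive (@quot_scale A) +%R.
Proof.
move=> t; elim/quot_class_ind => x; elim/quot_class_ind => y.
by rewrite -quot_classD !quot_scale_class scalerDr quot_classD.
Qed.

Lemma quot_scaleDl A (u : quot A) : {morph (@quot_scale A)^~ u : s t / s + t}.
Proof.
by elim/quot_class_ind: u => x s t /=; rewrite !quot_scale_class scalerDl quot_classD.
Qed.

HB.instance Definition _ A := GRing.Zmodule_isLmodule.Build R (quot A)
  (@quot_scaleA A) (@quot_scale1 A) (@quot_scaleDr A) (@quot_scaleDl A).

End Subspaces.

Section PreOrdered.
Context {R : realType} {X : povs R}.
Implicit Types (A : set X) (x y a b : X).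

Definition povs_le x y := wedge (y - x).

Definition order_ideal A :=
  is_subspace A /\
  forall a b x, A a -> A b -> povs_le a x -> povs_le x b -> A x.

Definition infinitesimals : set X :=
  [set x | exists2 xi : X, wedge xi &
     forall n, (0 < n)%N -> wedge (x *+ n + xi) /\ wedge (- (x *+ n) + xi)].

Lemma quot_class_is_linear A : linear (quot_class A).
Proof.
by move=> t x y; rewrite quot_classD -quot_scale_class.
Qed.

HB.instance Definition _ A :=
  GRing.isLinear.Build R X (quot A) *:%R (quot_class A) (quot_class_is_linear A).

Section QuotWedge.
Variable A : set X.
Definition quot_wedge : set (quot A) := quot_class A @` @wedge R X.

Lemma quot_wedge_nonempty : quot_wedge !=set0.
Proof. by have [x wx] := wedge_nonempty X; exists (quot_class A x), x. Qed.

Lemma quot_wedgeD u v : quot_wedge u -> quot_wedge v -> quot_wedge (u + v).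
Proof.
move=> [x wx <-] [y wy <-]; exists (x + y); first exact: wedgeD.
by rewrite linearD.
Qed.

Lemma quot_wedgeZ (t : R) u : 0 <= t -> quot_wedge u -> quot_wedge (t *: u).
Proof.
by move=> t0 [x wx <-]; exists (t *: x); [exact: wedgeZ|rewrite linearZ].
Qed.
End QuotWedge.

Definition quot_povs A : povs R :=
  POVS (@quot_wedge_nonempty A) (@quot_wedgeD A) (@quot_wedgeZ A).

End PreOrdered.

Arguments infinitesimals {R} X.
Arguments quot_povs {R} X A.

Section InfinitesimalIdeal.
Context {R : realType} {X : povs R}.
Implicit Types (x y : X).

Lemma wedge0 : wedge (0 : X).
Proof. by have [x wx] := wedge_nonempty X; rewrite -(scale0r x); apply: wedgeZ. Qed.

Lemma infinitesimalsP x : infinitesimals X x <->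
  exists2 xi : X, wedge xi & forall c : R, wedge (c *: x + xi).
Proof.
split=> -[xi wxi h]; exists xi => //; last first.
  by move=> n _; split; [rewrite -scaler_nat|rewrite -scaler_nat -scaleNr].
have pos (c : R) y : 0 <= c ->
    (forall n, (0 < n)%N -> wedge (y *+ n + xi)) -> wedge (c *: y + xi).
  move=> c0 hy; pose n := (Num.truncn c).+1.
  have cn : c < n%:R := truncnS_gt c.
  have n0 : n%:R != 0 :> R by rewrite pnatr_eq0.
  rewrite (_ : _ + xi = (c / n%:R) *: (y *+ n + xi) + (1 - c / n%:R) *: xi).
    apply: wedgeD; apply: wedgeZ => //; first by rewrite divr_ge0.
      exact: hy.
    by rewrite subr_ge0 ler_pdivrMr ?ltr0n// mul1r ltW.
  by rewrite scalerDr -scaler_nat scalerA divfK// -addrA -scalerDl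
     [_ + (1 - _)]addrC subrK scale1r.
move=> c; have [c0|c0] := leP 0 c; first by apply: pos => // n /h[].
rewrite -[c]opprK scaleNr -scalerN; apply: pos; first by rewrite oppr_ge0 ltW.
by move=> n /h[]; rewrite mulNrn.
Qed.

Lemma infinitesimals_ideal : order_ideal (infinitesimals X).
Proof.
split.
  split=> [|t x y /infinitesimalsP[xi wx hx] /infinitesimalsP[eta wy hy]].
    apply/infinitesimalsP; exists 0; first exact: wedge0.
    by move=> c; rewrite scaler0 addr0; exact: wedge0.
  apply/infinitesimalsP; exists (xi + eta); first exact: wedgeD.
  by move=> c; rewrite scalerDr scalerA addrACA; apply: wedgeD.
move=> a b x /infinitesimalsP[xi wx hx] /infinitesimalsP[eta wy hy] ax xb.
apply/infinitesimalsP; exists (xi + eta); first exact: wedgeD.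
move=> c; have [c0|c0] := leP 0 c.
  rewrite (_ : _ + _ = c *: (x - a) + (c *: a + xi) + eta).
    by do 2?apply: wedgeD => //; apply: wedgeZ.
  by rewrite scalerBr !addrA subrK.
rewrite (_ : _ + _ = (- c) *: (b - x) + (c *: b + eta) + xi).
  by do 2?apply: wedgeD => //; apply: wedgeZ => //; rewrite oppr_ge0 ltW.
by rewrite scaleNr -scalerN opprB scalerBr !addrA subrK -!addrA [eta + _]addrC.
Qed.

Lemma preimage_quot_ideal (A : set X) (J : set (quot_povs X A)) :
  order_ideal J -> order_ideal [set x | J (quot_class A x)].
Proof.
move=> [[J0 JD] Jc]; split.
  split=> [|t x y /= Jx Jy]; first by rewrite /= linear0.
  by rewrite linearP; apply: JD.
move=> a b x /= Ja Jb ax xb; apply: Jc Ja Jb _ _.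
  by exists (x - a) => //; rewrite linearB.
by exists (b - x) => //; rewrite linearB.
Qed.

End InfinitesimalIdeal.

Section InfinitesimalSequence.
Context {d : Order.disp_t} {W : ordinalsType d} {R : realType} (X : povs R).
Implicit Types (l g : W) (x : X).

(* N_l(X) *)
Definition inf_ideal : W -> set X :=
  Fix wf_lt (fun _ => set X) (fun l N =>
    if l == \bot then [set 0] else
    let M := [set x | exists g (gl : (g < l)%O), N g gl x] in
    [set x | infinitesimals (quot_povs X M) (quot_class M x)]).

(* M_l *)
Definition inf_union l : set X := \bigcup_(g in [set g | (g < l)%O]) inf_ideal g.

Lemma inf_idealE l : inf_ideal l =
  if l == \bot then [set 0] else
  [set x | infinitesimals (quot_povs X (inf_union l)) (quot_class (inf_union l) x)].
Proof.
have <- : [set x | exists g (_ : (g < l)%O), inf_ideal g x] = inf_union l.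
  by apply/seteqP; split=> x [g]; [case=> gl Ng; exists g|move=> gl Ng; exists g, gl].
rewrite {1}/inf_ideal Fix_eq //= => {}l f g fg.
by have -> : f = g by
  apply: functional_extensionality_dep => h; apply: functional_extensionality_dep.
Qed.

Lemma inf_ideal_le l g : (g <= l)%O -> inf_ideal g `<=` inf_ideal l.
Proof.
rewrite le_eqVlt => /orP[/eqP->//|gl] x Ngx.
rewrite inf_idealE gt_eqF ?(le_lt_trans _ gl) ?le0x//=.
rewrite (_ : quot_class _ x = 0); first by
  case: (@infinitesimals_ideal _ (quot_povs X (inf_union l))) => -[].
rewrite -(linear0 (quot_class (inf_union l))); apply/quot_classP.
by rewrite subr0; apply/asboolP => B _; apply; exists g.
Qed.

Lemma inf_ideal_order_ideal l : l <> \bot -> order_ideal (inf_ideal l).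
Proof.
move=> /eqP/negPf l0; rewrite inf_idealE l0.
exact/preimage_quot_ideal/infinitesimals_ideal.
Qed.

Lemma inf_ideal_subspace l : is_subspace (inf_ideal l).
Proof.
have [->|/eqP /inf_ideal_order_ideal[]//] := eqVneq l \bot.
rewrite inf_idealE eqxx; split=> // t x y -> ->.
by rewrite scaler0 addr0.
Qed.

Lemma inf_union_subspace l : l <> \bot -> is_subspace (inf_union l).
Proof.
move=> /eqP; rewrite -lt0x => l0; split; first by exists \bot => //;
  case: (inf_ideal_subspace \bot).
move=> t x y [g gl Ngx] [h hl Nhy]; exists (Order.max g h);
  first by rewrite /= gt_max gl.
case: (inf_ideal_subspace (Order.max g h)) => _; apply.
  by apply: inf_ideal_le Ngx; rewrite le_max lexx.
by apply: inf_ideal_le Nhy; rewrite le_max lexx orbT.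
Qed.

Lemma inf_union_order_ideal l : (ord_one < l)%O -> order_ideal (inf_union l).
Proof.
move=> l1; split=> [|a b x [g gl Nga] [h hl Nhb] ax xb].
  by apply: inf_union_subspace => l0; move: l1; rewrite l0 ltx0.
pose k := Order.max ord_one (Order.max g h); exists k; first by rewrite /= !gt_max l1 gl.
have k0 : k <> \bot.
  by apply/eqP; rewrite -one_le le_max lexx.
case: (inf_ideal_order_ideal k0) => _; apply; [| |exact: ax|exact: xb].
  by apply: inf_ideal_le Nga; rewrite !le_max lexx orbT.
by apply: inf_ideal_le Nhb; rewrite !le_max lexx !orbT.
Qed.

(* "lambda_X = l".  Only N_g for g <= l + 1 is involved, so it does not matter
   in which ordinal W the ordinal l is taken. *)
Definition almost_archimedeanization_type l :=
  inf_ideal (ord_succ l) = inf_ideal l /\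
  forall g, (g < l)%O -> inf_ideal (ord_succ g) <> inf_ideal g.

End InfinitesimalSequence.

Section Construction.
Context {d : Order.disp_t} {W : ordinalsType d}.
Implicit Types (a b : W).

(* The sequences A_a of the construction. The n-th term, n >= 1, of a sequence
   indexed by {1, 2, ...} is the value at n.-1 : nat, here and below. *)
Record ladder_system := LadderSystem {
  ladder :> W -> nat -> W;
  ladder_bounds : forall a n, is_limit a -> (ord_one <= ladder a n < a)%O;
  ladder_incr : forall a m n, is_limit a -> (m < n)%N ->
    (ladder a m < ladder a n)%O;
  ladder_cofinal : forall a b, is_limit a -> (b < a)%O ->
    exists n, (b <= ladder a n)%O
}.

Implicit Type A : ladder_system.

(* a(n) *)
Definition ord_seq A a (n : nat) : W :=
  if pselect (exists b, a = ord_succ b) is left h then sval (cid h) else A a n.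

Lemma succ_inj : injective (@ord_succ d W).
Proof.
move=> a b e; apply/le_anti.
rewrite !leNgt -!succ_le; apply/andP; split; first by rewrite -e succ_le ltxx.
by rewrite e succ_le ltxx.
Qed.

Lemma ord_seq_succ A b n : ord_seq A (ord_succ b) n = b.
Proof.
rewrite /ord_seq; case: pselect => [h|[]]; last by exists b.
exact/esym/succ_inj/(svalP (cid h)).
Qed.

Lemma ord_seq_limit A a n : is_limit a -> ord_seq A a n = A a n.
Proof.
move=> [_ nsucc]; rewrite /ord_seq; case: pselect => // h; exfalso.
by case: h => b; exact: nsucc.
Qed.

Lemma ord_seq_lt A a n :
  (ord_one < a)%O -> (ord_one <= ord_seq A a n < a)%O.
Proof.
move=> a1; have [[b ab]|nsucc] := pselect (exists b, a = ord_succ b).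
  rewrite ab ord_seq_succ lt_succ andbT; move: a1; rewrite ab.
  by rewrite [(_ < ord_succ b)%O]ltNge succ_le -leNgt.
have la : is_limit a.
  by split=> [a0|b ab]; [move: a1; rewrite a0 ltx0|apply: nsucc; exists b].
by rewrite ord_seq_limit// ladder_bounds.
Qed.

(* I_a; empty for a = 0 *)
Inductive coord A : W -> Type :=
| coord_one : coord A ord_one
| coord_node a n : (ord_one < a)%O -> coord A (ord_seq A a n) -> coord A a.

End Construction.

Arguments ladder_system {d} W.

Section Spaces.
Context {d : Order.disp_t} {W : ordinalsType d} (R : realType) (A : ladder_system W).
Implicit Types (a b : W).

Local Notation I := (coord A).

Definition slice a (a1 : (ord_one < a)%O) (x : I a -> R^o) n : I (ord_seq A a n) -> R^o :=
  fun i => x (coord_node a1 i).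
#[local] Arguments slice {a} a1 x n i.

Definition direct_sum a (E : forall n, set (I (ord_seq A a n) -> R^o)) :
    set (forall n, I (ord_seq A a n) -> R^o) :=
  [set y | (forall n, E n (y n)) /\ finite_set [set n | y n <> 0]].

(* Under the identification of the product of the R^I_(a(n)) with R^I_a, the
   element 1_a is the constant function 1.  S_a is the least family closed under
   the rules below; since a(n) < a this is the recursive definition (SspaceP).
   The first rule also sets S_0 = R^I_0 = {0}. *)
Inductive Sspace : forall a, (I a -> R^o) -> Prop :=
| Sspace_one a x : (a <= ord_one)%O -> Sspace (a := a) x
| Sspace_node a (a1 : (ord_one < a)%O) (p : {poly R}) y x :
    direct_sum (fun n => Sspace (a := ord_seq A a n)) y ->
    (forall n, slice a1 x n = p.[n.+1%:R] *: (cst 1 : _ -> R^o) + y n) ->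
    Sspace x.

(* H_a^b for b >= 1, cf. HspaceP_ge and HspaceP_lt *)
Inductive Hspace b : forall a, (I a -> R^o) -> Prop :=
| Hspace_ge a x : (a <= b)%O -> Sspace x -> Hspace b (a := a) x
| Hspace_lt a (a1 : (ord_one < a)%O) x : (b < a)%O ->
    direct_sum (fun n => Hspace b (a := ord_seq A a n)) (slice a1 x) -> Hspace b x.

Lemma Sspace1 a (x : I a -> R^o) : (a <= ord_one)%O -> Sspace x.
Proof. exact: Sspace_one. Qed.

Lemma SspaceP a (a1 : (ord_one < a)%O) (x : I a -> R^o) :
  Sspace x <-> exists (p : {poly R}) y,
    direct_sum (fun n => Sspace (a := ord_seq A a n)) y /\
    forall n, slice a1 x n = p.[n.+1%:R] *: (cst 1 : _ -> R^o) + y n.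
Proof.
split=> [Sx|[p [y [Sy xE]]]]; last exact: Sspace_node Sy xE.
case: a x / Sx a1 => [a x ax|a a1' p y x Sy xE] a1; first by move: ax; rewrite leNgt a1.
by exists p, y; split=> // n; rewrite (bool_irrelevance a1 a1').
Qed.

Lemma HspaceP_ge b a (x : I a -> R^o) : (a <= b)%O -> Hspace b x <-> Sspace x.
Proof.
move=> ab; split=> [Hx|]; last exact: Hspace_ge.
by case: a x / Hx ab => [//|a a1 x ba _]; rewrite leNgt ba.
Qed.

Lemma HspaceP_lt b a (a1 : (ord_one < a)%O) (x : I a -> R^o) : (b < a)%O ->
  Hspace b x <-> direct_sum (fun n => Hspace b (a := ord_seq A a n)) (slice a1 x).
Proof.
move=> ba; split=> [Hx|]; last exact: Hspace_lt.
case: a x / Hx a1 ba => [a x ab _|a a1' x _ Hx] a1 ba.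
  by move: ba; rewrite ltNge ab.
by rewrite (bool_irrelevance a1 a1').
Qed.

Lemma direct_sum_subspace a (E : forall n, set (I (ord_seq A a n) -> R^o))
    (t : R) (x y : forall n, I (ord_seq A a n) -> R^o) :
  (forall n, is_subspace (E n)) -> direct_sum E x -> direct_sum E y ->
  direct_sum E (fun n => t *: x n + y n).
Proof.
move=> sE [Ex fx] [Ey fy]; split=> [n|]; first by case: (sE n) => _; apply.
apply: (@sub_finite_set _ _ ([set n | x n <> 0] `|` [set n | y n <> 0])).
  by move=> n /= nz; apply: contrapT => /not_orP[/contrapT x0 /contrapT y0];
     apply: nz; rewrite x0 y0 scaler0 addr0.
by rewrite finite_setU.
Qed.

Lemma direct_sum0 a (E : forall n, set (I (ord_seq A a n) -> R^o)) :
  (forall n, is_subspace (E n)) -> direct_sum E (fun=> 0).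
Proof.
move=> sE; split=> [n|]; first by case: (sE n).
by rewrite (_ : [set _ | _] = set0) // -subset0 => n /=; apply.
Qed.

Lemma Sspace_subspace a : is_subspace (@Sspace a).
Proof.
elim/(@ord_ind d W): a => a IH; have [a1|a1] := leP a ord_one.
  by split=> *; exact: Sspace1.
have sS n : is_subspace (@Sspace (ord_seq A a n)).
  by apply: IH; case/andP: (ord_seq_lt A n a1).
split.
  apply/(SspaceP a1); exists 0, (fun=> 0); split; first exact: direct_sum0.
  by move=> n; rewrite horner0 scale0r addr0.
move=> t x y /(SspaceP a1)[p [u [Su xE]]] /(SspaceP a1)[q [v [Sv yE]]].
apply/(SspaceP a1); exists (t *: p + q), (fun n => t *: u n + v n).
split; first exact: direct_sum_subspace.
move=> n; rewrite (_ : slice _ _ _ = t *: slice a1 x n + slice a1 y n) //.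
by rewrite xE yE hornerD hornerZ scalerDl scalerDr scalerA addrACA.
Qed.

Lemma Hspace_subspace b a : (ord_one <= b)%O -> is_subspace (@Hspace b a).
Proof.
move=> b1; elim/(@ord_ind d W): a => a IH; have [ab|ba] := leP a b.
  have -> : @Hspace b a = @Sspace a by apply/seteqP; split=> x /HspaceP_ge; apply.
  exact: Sspace_subspace.
have a1 := le_lt_trans b1 ba.
have sH n : is_subspace (@Hspace b (ord_seq A a n)).
  by apply: IH; case/andP: (ord_seq_lt A n a1).
split=> [|t x y /(HspaceP_lt a1 _ ba) Hx /(HspaceP_lt a1 _ ba) Hy];
  apply/(HspaceP_lt a1 _ ba); first exact: direct_sum0.
exact: direct_sum_subspace.
Qed.

Definition Vpred a : {pred (I a -> R^o) * (I a -> R^o)} :=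
  fun v => `[< Hspace ord_one v.1 /\ Hspace a v.2 >].

Lemma Vpred_submod a : submod_closed (@Vpred a).
Proof.
have [H10 H1] := @Hspace_subspace ord_one a (lexx _).
have [Ha0 Ha] : is_subspace (@Hspace a a).
  have -> : @Hspace a a = @Sspace a by apply/seteqP; split=> x /HspaceP_ge; apply.
  exact: Sspace_subspace.
split=> [|t u v /asboolP[u1 u2] /asboolP[v1 v2]]; apply/asboolP; split=> //.
  exact: H1.
exact: Ha.
Qed.

HB.instance Definition _ a :=
  GRing.isSubmodClosed.Build R _ (@Vpred a) (@Vpred_submod a).

Record Vcar a := VCar { Vval :> (I a -> R^o) * (I a -> R^o); _ : Vval \in @Vpred a }.

HB.instance Definition _ a := [isSub for @Vval a].
HB.instance Definition _ a := [Choice of Vcar a by <:].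
HB.instance Definition _ a := [SubChoice_isSubLmodule of Vcar a by <:].

Definition Vwedge a : set (Vcar a) := [set v | forall i : I a,
  0 < v.1 i :> R \/ (0 = v.1 i :> R /\ 0 <= v.2 i :> R)].

Lemma Vwedge_nonempty a : @Vwedge a !=set0.
Proof. by exists 0 => i; right. Qed.

Lemma VwedgeD a (u v : Vcar a) : Vwedge u -> Vwedge v -> Vwedge (u + v).
Proof.
move=> hu hv i; rewrite !raddfD /= /GRing.add /=.
have [u1|[u1 u2]] := hu i; have [v1|[v1 v2]] := hv i.
- by left; exact: addr_gt0.
- by left; rewrite -v1 addr0.
- by left; rewrite -u1 add0r.
- by right; rewrite -u1 -v1 addr0; split=> //; exact: addr_ge0.
Qed.

Lemma VwedgeZ a (t : R) (v : Vcar a) : 0 <= t -> Vwedge v -> Vwedge (t *: v).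
Proof.
rewrite le_eqVlt => /orP[/eqP<- _ i|t0 hv i]; first by rewrite scale0r; right.
have e : Vval (t *: v) = t *: Vval v by exact: (GRing.valZ t v).
have e1 : (t *: v).1 i = t * (v.1 i : R) :> R by rewrite e.
have e2 : (t *: v).2 i = t * (v.2 i : R) :> R by rewrite e.
rewrite e1 e2; have [v1|[v1 v2]] := hv i; first by left; exact: mulr_gt0.
by right; rewrite -v1 mulr0; split=> //; exact: mulr_ge0 (ltW t0) v2.
Qed.

Lemma VvalB a (u v : Vcar a) i :
  ((u - v).1 i = (u.1 i : R) - v.1 i :> R) * ((u - v).2 i = (u.2 i : R) - v.2 i :> R).
Proof. by rewrite !raddfB. Qed.

Definition Vspace a : povs R := POVS (@Vwedge_nonempty a) (@VwedgeD a) (@VwedgeZ a).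

Lemma poly_pos_part (p : {poly R}) :
  exists (q : {poly R}) N, forall n, (N <= n)%N -> q.[n%:R] = Num.max 0 p.[n%:R].
Proof.
have [->|p0] := eqVneq p 0.
  by exists 0, 0%N => n _; rewrite horner0 maxxx.
pose c := polyrcf.cauchy_bound p; pose N := (Num.truncn c).+1.
have sg n : (N <= n)%N -> Num.sg p.[n%:R] = polyrcf.sgp_pinfty p.
  move=> Nn; apply: (polyrcf.sgp_pinftyP (polyrcf.ge_cauchy_bound p0)).
  by rewrite in_itv /= andbT (le_trans (ltW (truncnS_gt c)))// ler_nat.
exists (if 0 <= polyrcf.sgp_pinfty p then p else 0), N => n /sg <-.
by rewrite sgr_ge0; case: leP => // _; rewrite horner0.
Qed.

Lemma scale_cst1 (T : Type) (c : R) : c *: (cst 1 : T -> R^o) = cst c.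
Proof. by apply/funext => i; exact: mulr1. Qed.

Lemma Sspace_cst a (c : R) : Sspace (a := a) (fun=> c).
Proof.
elim/(@ord_ind d W): a => a IH; have [a1|a1] := leP a ord_one; first exact: Sspace1.
apply/(SspaceP a1); exists c%:P, (fun=> 0); split.
  by apply: direct_sum0 => n; apply: Sspace_subspace.
by move=> n; rewrite addr0 hornerC scale_cst1.
Qed.

Lemma Sspace_pos a (x : I a -> R^o) :
  Sspace x -> Sspace (fun i => Num.max 0 (x i : R)).
Proof.
elim/(@ord_ind d W): a x => a IH x; have [a1|a1] := leP a ord_one.
  by move=> _; exact: Sspace1.
move=> /(SspaceP a1)[p [y [[Sy fy] xE]]].
have [q [N qE]] := poly_pos_part p.
have Sx n : Sspace (slice a1 x n).
  rewrite xE; case: (Sspace_subspace (ord_seq A a n)) => _; apply => //.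
  exact: Sspace_cst.
apply/(SspaceP a1).
exists q, (fun n => (- q.[n.+1%:R]) *: (cst 1 : _ -> R^o) +
  (fun i => Num.max 0 (slice a1 x n i : R))); split; last first.
  by move=> n; rewrite addrA -scalerDl addrN scale0r add0r.
split=> [n|].
  case: (Sspace_subspace (ord_seq A a n)) => _; apply; first exact: Sspace_cst.
  by apply: IH => //; case/andP: (ord_seq_lt A n a1).
apply: (@sub_finite_set _ _ ([set n | y n <> 0] `|` `I_N)); last first.
  by rewrite finite_setU.
move=> n /= nz; apply: contrapT => /not_orP[/contrapT y0 /negP]; rewrite -leqNgt => Nn.
apply: nz; apply/funext => i; rewrite xE y0 addr0 !scale_cst1.
by rewrite (qE n.+1) ?leqW//; exact: addNr.
Qed.

Lemma Hspace_support b a (x y : I a -> R^o) : (ord_one <= b)%O ->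
  (forall i, x i = 0 -> y i = 0) -> Hspace ord_one x -> Hspace b y.
Proof.
move=> b1; elim/(@ord_ind d W): a x y => a IH x y xy.
have [a1|a1] := leP a ord_one.
  by move=> _; apply: Hspace_ge; [exact: le_trans b1|exact: Sspace1].
move=> /(HspaceP_lt a1 _ a1)[Hx fx].
have Hy n : Hspace b (slice a1 y n).
  apply: (IH _ _ (slice a1 x n)) => // [|i]; last exact: xy.
  by case/andP: (ord_seq_lt A n a1).
have fy : finite_set [set n | slice a1 y n <> 0].
  apply: sub_finite_set fx => n /= ny nx; apply: ny; apply/funext => i.
  by apply: xy; exact: (congr1 (fun f => f i) nx).
have [ab|ba] := leP a b; last by apply/(HspaceP_lt a1 _ ba).
apply: Hspace_ge => //; apply/(SspaceP a1); exists 0, (slice a1 y); split.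
  split=> // n; apply/HspaceP_ge; last exact: Hy.
  by apply: le_trans ab; apply: ltW; case/andP: (ord_seq_lt A n a1).
by move=> n; rewrite horner0 scale0r add0r.
Qed.

Definition is_vector_lattice (X : povs R) :=
  (forall x : X, wedge x -> wedge (- x) -> x = 0) /\
  forall x y : X, exists z, [/\ povs_le x z, povs_le y z &
    forall t, povs_le x t -> povs_le y t -> povs_le z t].

Lemma Vspace_vector_lattice a : is_vector_lattice (Vspace a).
Proof.
split=> [x x0 x0'|x y].
  have xi i : x.1 i = 0 :> R /\ x.2 i = 0 :> R.
    have := x0' i; rewrite -[- x]sub0r !VvalB !sub0r oppr_gt0 oppr_ge0.
    have [p|[e1 p]] := x0 i.
      by case=> [|[/eqP]]; rewrite ?ltNge ?(ltW p)// eq_sym oppr_eq0 gt_eqF.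
    rewrite -e1 ltxx; case=> // -[_ q]; split=> //.
    by apply/le_anti; rewrite p q.
  apply: val_inj; rewrite [LHS]surjective_pairing [RHS]surjective_pairing.
  by congr pair; apply/funext => i; case: (xi i).
pose u1 : I a -> R := fun i => (y.1 i : R) - x.1 i.
pose u2 : I a -> R := fun i => (y.2 i : R) - x.2 i.
pose w1 : I a -> R := fun i => Num.max 0 (u1 i).
pose w2 : I a -> R := fun i => if 0 < u1 i then u2 i else
  if u1 i == 0 then Num.max 0 (u2 i) else 0.
have /asboolP[Hu1 Hu2] : Vval (y - x) \in @Vpred a by apply: valP.
have {}Hu1 : Hspace (a := a) ord_one u1.
  by congr Hspace: Hu1; apply/funext => i; rewrite VvalB.
have {}Hu2 : Hspace (a := a) a u2.
  by congr Hspace: Hu2; apply/funext => i; rewrite VvalB.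
have Hw : (w1, w2) \in @Vpred a.
  apply/asboolP; split => /=.
    by apply: Hspace_support Hu1 => // i; rewrite /w1 => ->; rewrite maxxx.
  apply/HspaceP_ge => //.
  have /HspaceP_ge Su2 := Hu2; have {}Su2 := Sspace_pos (Su2 (lexx _)).
  have Sg : Sspace (a := a) (fun i => w2 i - Num.max 0 (u2 i)).
    apply/(@HspaceP_ge (Order.max ord_one a)); first by rewrite le_max lexx orbT.
    apply: Hspace_support Hu1; first by rewrite le_max lexx.
    by move=> i e; rewrite /w2 e ltxx eqxx subrr.
  have [_ /(_ 1 _ _ Sg Su2)] := Sspace_subspace a.
  congr Sspace; apply/funext => i; rewrite scale1r; exact: subrK.
pose w : Vspace a := VCar Hw.
exists (x + w); split; rewrite /povs_le /=.
- rewrite addrC addKr => i; rewrite /= /w1 /w2.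
  by case: (ltgtP 0 (u1 i)) => // u; [left|right|right; rewrite le_max lexx].
- rewrite (_ : x + w - y = w - (y - x)) => [i|]; last first.
    by rewrite opprB addrCA addrA.
  rewrite !VvalB /= -/(u1 i) /w1 /w2.
  have -> : (y.2 i : R) - x.2 i = u2 i by [].
  case: (ltgtP 0 (u1 i)) => u.
  + by right; rewrite !subrr.
  + by left; rewrite sub0r oppr_gt0.
  + by right; rewrite -/(u1 i) -u subrr subr_ge0 le_max lexx orbT.
move=> t xt yt i.
rewrite (_ : t - (x + w) = (t - x) - w); last by rewrite opprD addrA.
have := yt i; rewrite (_ : t - y = (t - x) - (y - x)); last first.
  by rewrite opprB addrA subrK.
have := xt i; rewrite [((t - x) - w).1 i]VvalB.
rewrite [X in _ -> _ -> _ \/ (_ /\ 0 <= X)]VvalB.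
move: (t - x) => s; rewrite !(VvalB s) !(VvalB y) /= -/(u1 i) -/(u2 i) /w1 /w2.
case: (ltgtP 0 (u1 i)) => // u.
  by rewrite !subr0.
rewrite -/(u1 i) -/(u2 i) -u !subr0.
move=> [s0 _|[s1 s2]]; first by left.
by case=> [|[_ su]]; [left|right; split=> //; rewrite subr_ge0 ge_max s2 -subr_ge0].
Qed.

End Spaces.

Arguments Vspace {d W} R A a.

(* Main.v *)
Require Import Defs.
From HB Require Import structures.
From mathcomp Require Import all_boot all_order all_algebra.
From mathcomp Require Import all_classical all_reals.

(** The filtration can be computed exactly: for every [l >= 1],
      [N_l(V_a) = {0} x H_a^l]    ([inf_idealP]).
    Granted this, [H_a^l = S_a] for [l >= a] gives [N_(a+1) = N_a], and for
    [g < a] the step from [N_g] to [N_(g+1)] is strict because [H_a^g] is a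
    proper subspace of [H_a^(g+1)] ([Hspace_neq]) or, for [g = 0], because
    [H_a^1] is nonzero ([Hspace1_neq0]).

    A bound [z] on all multiples [c v] modulo vectors with zero first component
    forces [v.1 = 0], since [c v.1(i) + z.1(i) >= 0] for all real [c].  On the
    finite support of [z.1] the second component of [v] is then unconstrained,
    and elsewhere [z.2] has to bound the multiples of [v.2].  For [l = 1] the
    bound is exact, so [v.2] lives on the support of [z.1], that is, [v.2] lies
    in [H_a^1].  For [l >= 2] the second components of [M_l] form the union [U]
    of the [H_a^g] with [1 <= g < l], which contains [H_a^1] and so absorbs the
    support of [z.1]; what remains is to show that the infinitesimals of the
    Archimedean space [S_a] modulo [U] are the elements of [H_a^l]
    ([infinitesimal_modP]).  This goes by induction on [a].
    - If [a < l], both [U] and [H_a^l] are all of [S_a].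
    - If [a = l], then [U] is the direct sum of the [S_(a(n))], and [S_a / U] is
      the space of polynomials ordered by their eventual sign.  There every
      [p] is infinitesimal, being dominated by ['X * (p ^+ 2 + 1)].
    - If [a > l], then [U] is the direct sum of its analogues in the blocks
      [a(n)], to which the induction hypothesis applies.  The polynomial part
      [p] of an infinitesimal vanishes at almost all [n]: elements of [U]
      have a zero in each block with [l <= a(n)], where a bound with polynomial
      part [q] therefore gives [c p(n) + q(n) >= 0] for all [c]. *)

Set Implicit Arguments.
Unset Strict Implicit.
Unset Printing Implicit Defensive.

Import Order.TTheory GRing.Theory Num.Theory.

Local Open Scope classical_set_scope.
Local Open Scope ring_scope.

(** * Real inequalities and quotients *)

Lemma eq0_of_affine_ge0 (R : realType) (x k : R) :
  (forall c, 0 <= c * x + k) -> x = 0.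
Proof.
move=> h; apply/eqP/contraT => x0.
by have := h (- (k + 1) / x); rewrite divfK// opprD addrAC addNr add0r oppr_ge0 ler10.
Qed.

(** Since [|t| <= t ^+ 2 + 1], the polynomial ['X * (p ^+ 2 + 1)] eventually
    dominates every real multiple of [p]. *)
Lemma affine_sqr_ge0 (R : realType) (c k t : R) :
  `|c| <= k -> 0 <= c * t + k * (t ^+ 2 + 1).
Proof.
move=> ck; rewrite addrC -[X in _ + X]opprK subr_ge0.
rewrite (le_trans (ler_norm _))// normrN normrM.
apply: ler_pM => //; rewrite -(real_normK (num_real t)).
have [t1|t1] := leP `|t| 1; first by rewrite (le_trans t1)// lerDr sqr_ge0.
by rewrite expr2 (le_trans (ler_peMl _ (ltW t1)))// lerDl.
Qed.

Lemma finite_set_natP (B : set nat) :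
  finite_set B <-> exists N, forall n, (N <= n)%N -> ~ B n.
Proof.
split=> [/finite_seqP[s ->]|[N BN]].
  exists (\max_(i <- s) i).+1 => n; rewrite ltnNge => /negP + ns; apply.
  exact: leq_bigmax_seq ns _.
apply: (@sub_finite_set _ _ `I_N); last exact: finite_II.
by move=> n /= Bn; rewrite ltnNge; apply/negP => /BN.
Qed.

(** The bound [z] need not be positive in [X] itself: the instance [c = 0] already
    says that its class is positive in the quotient. *)
Lemma infinitesimals_quotP (R : realType) (X : povs R) (A : set X) (x : X) :
  is_subspace A ->
  infinitesimals (quot_povs X A) (quot_class A x) <->
  exists z : X, forall c : R, exists2 m, A m & wedge (c *: x + z + m).
Proof.
move=> sA; have AE u : (u \in lin_span A) <-> A u.
  by rewrite -[X in _ <-> X u](lin_spanE sA).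
split=> [/infinitesimalsP[xi _]|[z hz]].
  move: xi; apply: (@quot_class_ind R X A) => z hz; exists z => c.
  have [w ww e] := hz c; exists (w - (c *: x + z)); last by rewrite addrCA subrr addr0.
  by apply/AE/quot_classP; rewrite e -linearP.
apply/infinitesimalsP.
have hw (c : R) : quot_wedge (quot_class A (c *: x + z)).
  have [m Am wm] := hz c; exists (c *: x + z + m) => //.
  by apply/quot_classP/AE; rewrite addrAC subrr add0r.
exists (quot_class A z) => [|c]; last by rewrite -linearP; exact: hw.
by have := hw 0; rewrite scale0r add0r.
Qed.

(** * Ladders and coordinates *)
Section Slices.
Context {d : Order.disp_t} {W : ordinalsType d} {R : realType}.
Context {A : ladder_system W}.
Implicit Types (a b l : W).

Local Notation I := (Defs.coord A).

Lemma succ_ge_one a : (ord_one <= ord_succ a)%O.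
Proof. by rewrite one_le gt_eqF// (le_lt_trans (le0x a) (lt_succ a)). Qed.

Lemma ord_seq_cofinal a b : (b < a)%O -> (ord_one < a)%O ->
  exists N, forall n, (N <= n)%N -> (b <= ord_seq A a n)%O.
Proof.
move=> ba a1; have [[c ac]|nsucc] := pselect (exists c, a = ord_succ c).
  by exists 0%N => n _; rewrite ac ord_seq_succ leNgt -succ_le -ac -ltNge.
have la : is_limit a.
  by split=> [a0|c ac]; [move: a1; rewrite a0 ltx0|apply: nsucc; exists c].
have [N bN] := ladder_cofinal A la ba; exists N => n.
rewrite ord_seq_limit// leq_eqVlt => /orP[/eqP<-//|Nn].
exact: le_trans bN (ltW (ladder_incr A la Nn)).
Qed.

Lemma coord_inhabited a : (ord_one <= a)%O -> inhabited (I a).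
Proof.
elim/(@ord_ind d W): a => a IH; rewrite le_eqVlt => /orP[/eqP<-|a1].
  exact: (inhabits (coord_one A)).
have /andP[s1 sa] := ord_seq_lt A 0 a1.
by have [i] := IH _ sa s1; exact: (inhabits (coord_node a1 i)).
Qed.

(** The inverse of [coord_node]; stated for a varying index because the index of
    [coord] is itself determined by the constructor. *)
Definition coord_split a (i : I a) :
    (ord_one < a)%O -> {n & I (ord_seq A a n)} :=
  match i in Defs.coord _ a' return (ord_one < a')%O -> {n & I (ord_seq A a' n)} with
  | coord_one => fun h => False_rect _ (notF (etrans (esym (ltxx _)) h))
  | coord_node _ n _ j => fun _ => existT _ n j
  end.

Lemma coord_nodeP a (a1 : (ord_one < a)%O) (i : I a) :
  exists n j, i = coord_node (n := n) a1 j.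
Proof.
case: a / i a1 => [a1|a n a1' j a1]; first by have := a1; rewrite ltxx.
by exists n, j; rewrite (bool_irrelevance a1 a1').
Qed.

Definition glue a (a1 : (ord_one < a)%O)
    (y : forall n, I (ord_seq A a n) -> R^o) : I a -> R^o :=
  fun i => y _ (projT2 (coord_split i a1)).

Lemma slice_glue a (a1 : (ord_one < a)%O) y : slice a1 (glue a1 y) = y.
Proof. by []. Qed.

(** * Slices of [S_a] and of [H_a^b] *)
Definition block a (a1 : (ord_one < a)%O) n (x : I (ord_seq A a n) -> R^o) :=
  glue a1 (dfwith (fun n => 0 : I (ord_seq A a n) -> R^o) n x).

Lemma direct_sumP a (E : forall n, set (I (ord_seq A a n) -> R^o)) y :
  direct_sum E y <-> (forall n, E n (y n)) /\
    exists N, forall n, (N <= n)%N -> y n = 0.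
Proof.
rewrite /direct_sum /= finite_set_natP.
split=> -[Ey [N hN]]; split=> //; exists N => n Nn; first exact: contrapT (hN n Nn).
by move=> /(_ (hN n Nn)).
Qed.

Lemma direct_sum_block a (a1 : (ord_one < a)%O)
    (E : forall n, set (I (ord_seq A a n) -> R^o)) n x :
  (forall k, E k 0) ->
  direct_sum E (slice a1 (block a1 x)) <-> E n x.
Proof.
move=> E0; rewrite slice_glue; split=> [[Ex _]|Ex].
  by have := Ex n; rewrite dfwithin.
apply/direct_sumP; split=> [k|]; first by case: dfwithP.
by exists n.+1 => k nk; rewrite dfwithout//; apply: contraTneq nk => ->; rewrite ltnn.
Qed.

Lemma Sspace_slice a (a1 : (ord_one < a)%O) (x : I a -> R^o) n :
  Sspace x -> Sspace (slice a1 x (n := n)).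
Proof.
move=> /(SspaceP a1)[p [y [[Sy _] xE]]].
rewrite xE; have [_ SD] := Sspace_subspace R A (ord_seq A a n).
by apply: SD => //; exact: Sspace_cst.
Qed.

Lemma Sspace_direct_sum a (a1 : (ord_one < a)%O) (x : I a -> R^o) :
  direct_sum (fun n => Sspace (a := ord_seq A a n)) (slice a1 x) -> Sspace x.
Proof.
move=> Sx; apply/(SspaceP a1); exists 0, (slice a1 x); split=> // n.
by rewrite horner0 scale0r add0r.
Qed.

Lemma Hspace_Sspace b a (x : I a -> R^o) : Hspace b x -> Sspace x.
Proof.
elim/(@ord_ind d W): a x => a IH x; have [ab|ba] := leP a b.
  by move/HspaceP_ge; apply.
have [a1|a1] := leP a ord_one; first by move=> _; exact: Sspace1.
move=> /(HspaceP_lt a1 _ ba)[Hx fx]; apply/(Sspace_direct_sum (a1 := a1)).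
by split=> // n; apply: IH => //; case/andP: (ord_seq_lt A n a1).
Qed.

Lemma Hspace_le b b' a (x : I a -> R^o) :
  (ord_one <= b)%O -> (b <= b')%O -> Hspace b x -> Hspace b' x.
Proof.
move=> b1 bb'; elim/(@ord_ind d W): a x => a IH x; have [ab|ba] := leP a b'.
  by move=> Hx; apply/HspaceP_ge => //; exact: Hspace_Sspace Hx.
have ba' := le_lt_trans bb' ba; have a1 := le_lt_trans b1 ba'.
move=> /(HspaceP_lt a1 _ ba')[Hx fx]; apply/(HspaceP_lt a1 _ ba).
by split=> // n; apply: IH => //; case/andP: (ord_seq_lt A n a1).
Qed.

(** For [b < a] all but finitely many blocks of an element of [H_a^b] vanish. This
    separates [H_a^b] from the constants. *)
Lemma Hspace_lt_zero b a (x : I a -> R^o) :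
  (ord_one <= b < a)%O -> Hspace b x -> exists i, x i = 0.
Proof.
move=> /andP[b1 ba]; have a1 := le_lt_trans b1 ba.
move=> /(HspaceP_lt a1 _ ba)/direct_sumP[_ [N /(_ _ (leqnn N)) xN]].
have /andP[/coord_inhabited[j] _] := ord_seq_lt A N a1.
by exists (coord_node a1 j); have := congr1 (fun f => f j) xN.
Qed.

(** At [a = b + 1] the constant function [1_a] is the witness; larger [a] have a
    block [a(n) > b] from which a witness extends by zero. *)
Lemma Hspace_neq b a : (ord_one <= b < a)%O ->
  exists x : I a -> R^o, Hspace (ord_succ b) x /\ ~ Hspace b x.
Proof.
move=> /andP[b1]; elim/(@ord_ind d W): a => a IH ba.
have a1 := le_lt_trans b1 ba.
move: (ba); rewrite -succ_le le_eqVlt => /orP[/eqP ab|sba].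
  exists (cst 1); split.
    by apply/HspaceP_ge; [rewrite ab|exact: Sspace_cst].
  move=> /Hspace_lt_zero; rewrite b1 ba => /(_ isT)[i /eqP].
  by rewrite oner_eq0.
have [N /(_ _ (leqnn N))] := ord_seq_cofinal sba a1; rewrite succ_le => bN.
have /andP[_ Na] := ord_seq_lt A N a1.
have [x [Hx nHx]] := IH _ Na bN.
exists (block a1 x); split.
  apply/(HspaceP_lt a1 _ sba)/direct_sum_block => // k.
  by case: (Hspace_subspace R A (ord_seq A a k) (succ_ge_one b)).
move=> /(HspaceP_lt a1 _ ba)/direct_sum_block H; apply/nHx/H => k.
by case: (Hspace_subspace R A (ord_seq A a k) b1).
Qed.

Lemma Hspace1_neq0 a : (ord_one <= a)%O ->
  exists x : I a -> R^o, Hspace ord_one x /\ x <> 0.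
Proof.
elim/(@ord_ind d W): a => a IH a1; have [a1'|{}a1] := leP a ord_one.
  exists (cst 1); split; first by apply: Hspace_ge => //; exact: Sspace1.
  have [i] := coord_inhabited a1; move=> /(congr1 (fun f => f i))/eqP.
  by rewrite oner_eq0.
have /andP[s1 sa] := ord_seq_lt A 0 a1; have [x [Hx x0]] := IH _ sa s1.
exists (block a1 x); split.
  apply/(HspaceP_lt a1 _ a1)/direct_sum_block => // k.
  by case: (Hspace_subspace R A (ord_seq A a k) (lexx ord_one)).
move=> e; apply: x0.
have <- : slice a1 (block a1 x) (n := 0%N) = x by rewrite slice_glue dfwithin.
by rewrite e.
Qed.

(** * Infinitesimals of [S_a] modulo the union of the smaller [H_a^g] *)

Definition Hunion l a : set (I a -> R^o) :=
  [set x | exists2 g, (ord_one <= g < l)%O & Hspace g x].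
Arguments Hunion : clear implicits.

Lemma Hunion_ge l a (x : I a -> R^o) : (ord_one < l)%O -> (a < l)%O ->
  Hunion l a x <-> Sspace x.
Proof.
move=> l1 al; split=> [[g _ /Hspace_Sspace]//|Sx].
exists (Order.max ord_one a); first by rewrite le_max lexx gt_max l1 al.
by apply: Hspace_ge => //; rewrite le_max lexx orbT.
Qed.

(** A finite direct sum of elements of [H^g] with varying [g < l] lies in [H^g] for
    their maximum.  The case [l = a] is included: then every block [a(n)] is
    below [l] and contributes all of [S_(a(n))]. *)
Lemma HunionP l a (a1 : (ord_one < a)%O) (x : I a -> R^o) :
  (ord_one < l <= a)%O ->
  Hunion l a x <-> direct_sum (fun n => Hunion l (ord_seq A a n)) (slice a1 x).
Proof.
move=> /andP[l1 la]; split=> [[g /andP[g1 gl]]|/direct_sumP[Hx [N xN]]].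
  move=> /(HspaceP_lt a1 _ (lt_le_trans gl la))[Hx fx]; split=> // n.
  by exists g => //; rewrite g1.
have [g gl Hg] : exists2 g, (ord_one <= g < l)%O &
    forall n, (n < N)%N -> Hspace g (slice a1 x (n := n)).
  elim: N {xN} => [|N [g /andP[g1 gl] Hg]]; first by exists ord_one; rewrite ?lexx.
  have [h /andP[h1 hl] Hh] := Hx N; exists (Order.max g h).
    by rewrite le_max g1 gt_max gl.
  move=> n; rewrite ltnS leq_eqVlt => /orP[/eqP->|/Hg].
    by apply: Hspace_le Hh => //; rewrite le_max lexx orbT.
  by apply: Hspace_le => //; rewrite le_max lexx.
have /andP[g1 gl'] := gl; exists g => //.
apply/(HspaceP_lt a1 _ (lt_le_trans gl' la))/direct_sumP; split; last by exists N.
move=> n; have [/Hg//|/xN->] := ltnP n N.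
by case: (Hspace_subspace R A (ord_seq A a n) g1).
Qed.

Lemma Hunion_subspace l a : (ord_one < l)%O -> is_subspace (Hunion l a).
Proof.
move=> l1; split=> [|t x y [g /andP[g1 gl] Hx] [h /andP[h1 hl] Hy]].
  exists ord_one; first by rewrite lexx.
  by case: (Hspace_subspace R A a (lexx ord_one)).
exists (Order.max g h); first by rewrite le_max g1 gt_max gl.
have [|_] := Hspace_subspace R A a (b := Order.max g h); first by rewrite le_max g1.
by apply; [apply: Hspace_le Hx|apply: Hspace_le Hy]; rewrite // le_max lexx ?orbT.
Qed.

(** The infinitesimals of [S_a / M] in the form given by [infinitesimals_quotP];
    [S_a] is only a subset of the functions on [I_a] here. *)
Definition infinitesimal_mod a (M : set (I a -> R^o)) : set (I a -> R^o) :=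
  [set y | exists2 z, Sspace z &
     forall c : R, exists2 m, M m & forall i, 0 <= c * y i + z i + m i :> R].

Lemma infinitesimal_mod_eq a (y : I a -> R^o) : (ord_one < a)%O ->
  Sspace y -> infinitesimal_mod (Hunion a a) y.
Proof.
move=> a1 Sy; have [p [u [/direct_sumP[Su [N uN]] yE]]] := (SspaceP a1 y).1 Sy.
pose q : {poly R} := 'X * (p ^+ 2 + 1).
pose z : I a -> R^o := glue a1 (fun n => cst q.[n.+1%:R]).
have Sz : Sspace z.
  apply/(SspaceP a1); exists q, (fun=> 0); split => [|n]; last first.
    by rewrite slice_glue scale_cst1 addr0.
  by apply: direct_sum0 => n; exact: Sspace_subspace.
exists z => // c.
(* from [K] on, the slice of [y] is the constant [p(n + 1)] and [|c| <= n] *)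
pose K := maxn N (Num.truncn `|c|).+1.
pose m : I a -> R^o := glue a1 (fun n =>
  if (n < K)%N then - c *: slice a1 y (n := n) - slice a1 z (n := n) else 0).
exists m.
  apply/(HunionP a1); first by rewrite a1 lexx.
  rewrite slice_glue; apply/direct_sumP; split=> [n|]; last first.
    by exists K => n; rewrite leqNgt => /negPf->.
  apply/(Hunion_ge _ a1); first by case/andP: (ord_seq_lt A n a1).
  have [S0 SD] := Sspace_subspace R A (ord_seq A a n).
  case: ifP => // _; apply: (SD); first exact: Sspace_slice.
  by rewrite -scaleN1r -[_ *: _]addr0; apply: (SD) => //; exact: Sspace_slice.
move=> i; have [n [j ->]] := coord_nodeP a1 i.
rewrite /m /glue /=; case: ltnP => [nK|].
  have -> : (- c *: slice a1 y (n := n) - slice a1 z (n := n)) j =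
      - c * y (coord_node a1 j) - z (coord_node a1 j) :> R by [].
  by rewrite mulNr addrACA !subrr addr0.
rewrite geq_max => /andP[Nn cn].
rewrite [(0 : _ -> _) j]/(0 : R) addr0.
have -> : y (coord_node a1 j) = p.[n.+1%:R] :> R.
  have := congr1 (fun f => f j) (yE n); rewrite uN// addr0 scale_cst1.
  exact.
have -> : z (coord_node a1 j) = q.[n.+1%:R] by [].
rewrite /q !hornerE; apply: affine_sqr_ge0.
by rewrite (le_trans (ltW (truncnS_gt _)))// ler_nat ltnW.
Qed.

Lemma infinitesimal_mod_slice l a (a1 : (ord_one < a)%O) (y : I a -> R^o) n :
  (ord_one < l <= a)%O -> infinitesimal_mod (Hunion l a) y ->
  infinitesimal_mod (Hunion l (ord_seq A a n)) (slice a1 y (n := n)).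
Proof.
move=> la [z Sz hz]; exists (slice a1 z (n := n)); first exact: Sspace_slice.
move=> c; have [m /(HunionP a1 _ la)[Hm _] cm] := hz c.
by exists (slice a1 m (n := n)) => // j; exact: cm.
Qed.

(** On all but finitely many blocks [y] and the bound [z] are constants [p(n + 1)]
    and [q(n + 1)], while the correction [m] has a zero there. *)
Lemma infinitesimal_mod_finite l a (a1 : (ord_one < a)%O) (y : I a -> R^o) :
  (ord_one < l < a)%O -> Sspace y -> infinitesimal_mod (Hunion l a) y ->
  exists N, forall n, (N <= n)%N -> slice a1 y (n := n) = 0.
Proof.
move=> /andP[l1 la] /(SspaceP a1)[p [u [/direct_sumP[_ [N1 uN]] yE]]].
move=> [z /(SspaceP a1)[q [v [/direct_sumP[_ [N2 vN]] zE]]] hz].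
have [N3 lN] := ord_seq_cofinal la a1.
exists (maxn N1 (maxn N2 N3)) => n; rewrite !geq_max => /and3P[n1 n2 n3].
suff p0 : p.[n.+1%:R] = 0 by rewrite yE uN// p0 scale0r addr0.
apply: (@eq0_of_affine_ge0 _ _ q.[n.+1%:R]) => c.
have [m /(HunionP a1) + cm] := hz c; rewrite l1 ltW// => /(_ isT)[/(_ n)].
move=> [g /andP[g1 gl] Hm] _.
have [|j mj] := Hspace_lt_zero _ Hm; first by rewrite g1 (lt_le_trans gl)// lN.
have := cm (coord_node a1 j).
have -> : y (coord_node a1 j) = p.[n.+1%:R] :> R.
  have := congr1 (fun f => f j) (yE n); rewrite uN// addr0 scale_cst1.
  exact.
have -> : z (coord_node a1 j) = q.[n.+1%:R] :> R.
  have := congr1 (fun f => f j) (zE n); rewrite vN// addr0 scale_cst1.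
  exact.
by rewrite [m _]mj addr0.
Qed.

Lemma infinitesimal_mod_glue l a (a1 : (ord_one < a)%O) (y : I a -> R^o) :
  (ord_one < l <= a)%O ->
  direct_sum (fun n => infinitesimal_mod (Hunion l (ord_seq A a n))) (slice a1 y) ->
  infinitesimal_mod (Hunion l a) y.
Proof.
move=> la /direct_sumP[hy [N yN]]; have l1 : (ord_one < l)%O by case/andP: la.
pose z n := s2val (cid2 (hy n)).
have Sz n : Sspace (z n) := s2valP (cid2 (hy n)).
(* the bounds of the vanishing slices may be replaced by zero *)
pose cut (f : forall n, I (ord_seq A a n) -> R^o) n := if (n < N)%N then f n else 0.
exists (glue a1 (cut z)).
  apply/(Sspace_direct_sum (a1 := a1))/direct_sumP; split=> [n|]; last first.
    by exists N => n; rewrite slice_glue /cut leqNgt => /negPf->.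
  rewrite slice_glue /cut; case: ifP => _; first exact: Sz.
  by case: (Sspace_subspace R A (ord_seq A a n)).
move=> c; pose m n := s2val (cid2 (s2valP' (cid2 (hy n)) c)).
have Hm n : Hunion l (ord_seq A a n) (m n) :=
  s2valP (cid2 (s2valP' (cid2 (hy n)) c)).
have cm n j : 0 <= c * slice a1 y (n := n) j + z n j + m n j :> R :=
  s2valP' (cid2 (s2valP' (cid2 (hy n)) c)) j.
exists (glue a1 (cut m)).
  apply/(HunionP a1) => //; apply/direct_sumP; split=> [n|]; last first.
    by exists N => n; rewrite slice_glue /cut leqNgt => /negPf->.
  rewrite slice_glue /cut; case: ifP => _; first exact: Hm.
  by case: (Hunion_subspace (ord_seq A a n) l1).
move=> i; have [n [j ->]] := coord_nodeP a1 i; rewrite /glue /= /cut.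
case: ltnP => [_|/yN yn]; first exact: cm.
have -> : y (coord_node a1 j) = 0 := congr1 (fun f => f j) yn.
by rewrite mulr0 !add0r.
Qed.

Lemma infinitesimal_modP l a (y : I a -> R^o) : (ord_one < l)%O ->
  Sspace y -> infinitesimal_mod (Hunion l a) y <-> Hspace l y.
Proof.
move=> l1; elim/(@ord_ind d W): a y => a IH y Sy.
have [al|la|al] := ltgtP a l.
- split=> _; first by apply: Hspace_ge => //; exact: ltW.
  have [S0 SD] := Sspace_subspace R A a.
  exists 0 => // c; exists (- c *: y).
    by apply/Hunion_ge => //; rewrite -[_ *: _]addr0; exact: SD.
  by move=> i; rewrite [0 i]/(0 : R) addr0 -mulrDl subrr mul0r.
- have a1 := lt_trans l1 la.
  have sa n : (ord_seq A a n < a)%O by case/andP: (ord_seq_lt A n a1).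
  split=> [hy|/(HspaceP_lt a1 _ la)[Hy fy]].
    apply/(HspaceP_lt a1 _ la)/direct_sumP; split=> [n|]; last first.
      by apply: infinitesimal_mod_finite hy; rewrite ?l1.
    apply/(IH _ (sa n)); first exact: Sspace_slice.
    by apply: infinitesimal_mod_slice hy; rewrite l1 ltW.
  apply: (infinitesimal_mod_glue (a1 := a1)); first by rewrite l1 ltW.
  split=> // n; apply/(IH _ (sa n)); [exact: Sspace_slice|exact: Hy].
- subst l; split=> _; first exact: Hspace_ge.
  exact: infinitesimal_mod_eq.
Qed.

(** * The spaces *)

(** * The ideals [N_l(V_a)] *)
Lemma Hspace_full a (x : I a -> R^o) : Hspace a x <-> Sspace x.
Proof. exact: HspaceP_ge. Qed.

Lemma VspaceP a (v : Vspace R A a) : Hspace ord_one v.1 /\ Hspace a v.2.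
Proof. exact/asboolP/(valP v). Qed.

Lemma Vspace_intro a (x y : I a -> R^o) : Hspace ord_one x -> Sspace y ->
  {v : Vspace R A a | v.1 = x /\ v.2 = y}.
Proof.
move=> Hx Sy; have xyV : (x, y) \in @Vpred _ _ R A a.
  by apply/asboolP; split=> //; exact/Hspace_full.
by exists (VCar xyV).
Qed.

Lemma Vval_affine a (c : R) (u v w : Vcar R A a) i :
  ((c *: u + v + w).1 i = c * u.1 i + v.1 i + w.1 i :> R) *
  ((c *: u + v + w).2 i = c * u.2 i + v.2 i + w.2 i :> R).
Proof.
have e : Vval (c *: u + v + w) = c *: Vval u + Vval v + Vval w.
  rewrite -[LHS]/(val (c *: u + v + w)) 2!raddfD; congr (_ + _ + _).
by rewrite e.
Qed.

Lemma wedge_affineP a (c : R) (u v w : Vspace R A a) :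
  wedge (c *: u + v + w) <-> forall i,
  0 < c * u.1 i + v.1 i + w.1 i :> R \/
  (0 = c * u.1 i + v.1 i + w.1 i :> R /\ 0 <= c * u.2 i + v.2 i + w.2 i :> R).
Proof.
by split=> h i; have := h i; rewrite !(Vval_affine c u v w i).
Qed.

Lemma inf_ideal_neq0P (X : povs R) l (x : X) : (ord_one <= l)%O ->
  inf_ideal l x <->
  exists z : X, forall c : R, exists2 m, inf_union l m & wedge (c *: x + z + m).
Proof.
rewrite one_le => l0; rewrite inf_idealE (negPf l0).
by apply: infinitesimals_quotP; apply/inf_union_subspace/eqP.
Qed.

Lemma inf_ideal_fst0 a l (v : Vspace R A a) : (ord_one <= l)%O ->
  (forall m : Vspace R A a, inf_union l m -> m.1 = 0) ->
  inf_ideal l v -> v.1 = 0.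
Proof.
move=> l1 M0 /(inf_ideal_neq0P _ l1)[z hz]; apply/funext => i.
apply: (@eq0_of_affine_ge0 _ _ (z.1 i)) => c.
have [m /M0 m1 /wedge_affineP/(_ i)] := hz c.
by rewrite m1 addr0 => -[/ltW//|[<-]].
Qed.

(** Modulo zero, the coordinates at which the bound may be lexicographically
    large are those in the support of its first component, which is an element
    of [H_a^1]; conversely the indicator of the support of [v.2] is a bound. *)
Lemma inf_ideal1P a (v : Vspace R A a) :
  inf_ideal (ord_one : W) v <-> v.1 = 0 /\ Hspace ord_one v.2.
Proof.
have M0 (m : Vspace R A a) : inf_union (ord_one : W) m <-> m = 0.
  split=> [[g /=]|->]; last first.
    case: (@inf_union_subspace _ W R (Vspace R A a) ord_one) => //.
    by apply/eqP; rewrite -one_le.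
  by rewrite ltNge one_le negbK => /eqP->; rewrite inf_idealE eqxx.
have V1 := @lexx _ W ord_one.
split=> [hv|[v1 v2]].
  have v1 : v.1 = 0 by apply: inf_ideal_fst0 hv => // m /M0->.
  split=> //; have [z hz] := (inf_ideal_neq0P _ V1).1 hv.
  have [Hz _] := VspaceP z; apply: Hspace_support Hz => // i zi.
  apply: (@eq0_of_affine_ge0 _ _ (z.2 i)) => c.
  have [m /M0-> /wedge_affineP/(_ i)] := hz c.
  by rewrite v1 zi !addr0 mulr0 ltxx => -[//|[_]].
pose x : I a -> R^o := fun i => if v.2 i == 0 then 0 else 1.
have Hx : Hspace ord_one x.
  by apply: Hspace_support v2 => // i vi; rewrite /x vi eqxx.
have [S0 _] := Sspace_subspace R A a.
have [z [z1 z2]] := Vspace_intro Hx S0.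
apply/inf_ideal_neq0P => //; exists z => c; exists 0; first exact/M0.
apply/wedge_affineP => i; rewrite v1 z1 z2 /x.
have [->|_] := eqVneq (v.2 i) 0; last first.
  by left; rewrite addr0 mulr0 add0r ltr01.
by right; rewrite !addr0 !mulr0.
Qed.

(** For [l > 1] the support of the first component of the bound is harmless: the
    correction [w], supported there, lies in [H_a^1], hence in [Hunion l a]. *)
Lemma inf_idealP a l (v : Vspace R A a) : (ord_one <= l)%O ->
  inf_ideal l v <-> v.1 = 0 /\ Hspace l v.2.
Proof.
elim/(@ord_ind d W): l v => l IH v; rewrite le_eqVlt => /orP[/eqP<-|l1].
  exact: inf_ideal1P.
have MP (m : Vspace R A a) : inf_union l m <-> m.1 = 0 /\ Hunion l a m.2.
  split=> [[g gl]|[m1 [g /andP[g1 gl] Hm]]]; last by exists g => //; apply/IH.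
  have [->|] := eqVneq g \bot%O.
    rewrite inf_idealE eqxx => ->; split=> //.
    by case: (Hunion_subspace a l1).
  by rewrite -one_le => g1 /(IH _ gl _ g1)[m1 Hm]; split=> //; exists g; rewrite ?g1.
have Sv : Sspace v.2 by case: (VspaceP v) => _ /Hspace_full.
have l1' := ltW l1.
split=> [hv|[v1 /(infinitesimal_modP l1 Sv)[z Sz hz]]].
  have v1 : v.1 = 0 by apply: inf_ideal_fst0 hv => // m /MP[].
  split=> //; apply/(infinitesimal_modP l1 Sv).
  have [z hz] := (inf_ideal_neq0P _ l1').1 hv.
  have [Hz /Hspace_full Sz] := VspaceP z.
  exists z.2 => // c; have [m /MP[m1 Hm] /wedge_affineP cm] := hz c.
  (* [w] makes the sum vanish on the support of [z.1] *)
  pose w : I a -> R^o := fun i =>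
    if z.1 i == 0 then 0 else - (c * v.2 i + z.2 i + m.2 i : R).
  have Hw : Hunion l a w.
    exists ord_one; first by rewrite lexx.
    by apply: Hspace_support Hz => // i zi; rewrite /w zi eqxx.
  exists (1 *: m.2 + w).
    by have [_ MD] := Hunion_subspace a l1; exact: MD.
  move=> i; have := cm i; rewrite v1 m1.
  have -> : (1 *: m.2 + w) i = m.2 i + w i :> R by rewrite scale1r.
  rewrite addrA /w; case: eqP => [->|_ _]; last by rewrite subrr.
  by rewrite !addr0 mulr0 ltxx => -[//|[_]].
have [H0 _] := Hspace_subspace R A a (lexx ord_one).
have [z' [z1 z2]] := Vspace_intro H0 Sz.
apply/inf_ideal_neq0P => //; exists z' => c; have [m Hm cm] := hz c.
have Sm : Sspace m by case: Hm => g _ /Hspace_Sspace.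
have [m' [m1 m2]] := Vspace_intro H0 Sm.
exists m'; first by apply/MP; rewrite m1 m2.
apply/wedge_affineP => i; rewrite v1 z1 z2 m1 m2; right.
by rewrite !addr0 mulr0; split => //; exact: cm.
Qed.

Lemma Vspace_almost_archimedeanization_type a : (ord_one <= a)%O ->
  almost_archimedeanization_type (Vspace R A a) a.
Proof.
move=> a1; split.
  apply/seteqP; split=> v; rewrite !inf_idealP// ?succ_ge_one// => -[-> _]; split=> //.
    by case: (VspaceP v).
  apply: Hspace_ge; first exact/ltW/lt_succ.
  by case: (VspaceP v) => _ /Hspace_full.
move=> g ga e; have [g0|g0] := eqVneq g \bot%O.
  have [x [Hx x0]] := Hspace1_neq0 a1.
  have [H0 _] := Hspace_subspace R A a (lexx ord_one).
  have [v [v1 v2]] := Vspace_intro H0 (Hspace_Sspace Hx).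
  have : inf_ideal (ord_succ g) v by rewrite g0 inf_idealP ?lexx// v1 v2.
  by rewrite e g0 inf_idealE eqxx => v0; apply: x0; rewrite -v2 v0.
have g1 : (ord_one <= g)%O by rewrite one_le.
have [|x [Hx nHx]] := @Hspace_neq g a; first by rewrite g1.
have [H0 _] := Hspace_subspace R A a (lexx ord_one).
have [v [v1 v2]] := Vspace_intro H0 (Hspace_Sspace Hx).
apply: nHx; suff /(inf_idealP _ g1)[_] : inf_ideal g v by rewrite v2.
by rewrite -e; apply/inf_idealP; rewrite ?succ_ge_one// v1 v2.
Qed.

End Slices.

Theorem theorem4p2 (R : realType) (A : ladder_system omega1) (a : omega1)
    (ha : (ord_one <= a)%O) :
  almost_archimedeanization_type (Vspace R A a) a.
Proof. exact: Vspace_almost_archimedeanization_type. Qed.
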